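(* The class of multi-path matroids is closed under deletion: if $M$ is a multi-path matroid and $x$ is an element of $M$, then $M\backslash x$ is a multi-path matroid.
   Context: Transversal matroid $M[\mathcal{A}]$ of a multiset $\mathcal{A}=(A_j:j\in J)$ of subsets of a finite set $S$: independent sets are the sets $\{x_k:k\in K\}$ of $|K|$ distinct elements with $K\subseteq J$, $x_k\in A_k$; $\mathcal{A}$ is a presentation. For a cyclic permutation $\sigma$ of $S$, a $\sigma$-interval is a nonempty set $\{f,\sigma(f),\ldots,l\}$. A multi-path matroid is a transversal matroid with a presentation by an antichain (no member containing another) of $\sigma$-intervals for some cyclic permutation $\sigma$ of its ground set. *)

(* Defs.v *)
From HB Require Import structures.
From mathcomp Require Import all_boot all_fingroup.

Set Implicit Arguments.
Unset Strict Implicit.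
Unset Printing Implicit Defensive.

(* A matroid on a ground set contained in T, by its independent sets. *)
Record matroid (T : finType) := Matroid {
  ground : {set T};
  indep : {set {set T}};
  indep_ground : forall X, X \in indep -> X \subset ground;
  indep_set0 : set0 \in indep;
  indep_subset : forall X Y : {set T},
    X \subset Y -> Y \in indep -> X \in indep;
  indep_augment : forall X Y : {set T},
    X \in indep -> Y \in indep -> #|X| < #|Y| ->
    exists2 y, y \in Y :\: X & y |: X \in indep
}.

Section Deletion.

Variables (T : finType) (M : matroid T) (x : T).

Definition del_ground : {set T} := ground M :\ x.
Definition del_indep : {set {set T}} :=
  [set X in indep M | X \subset del_ground].

Lemma del_indep_ground X : X \in del_indep -> X \subset del_ground.
Proof. by rewrite inE => /andP[]. Qed.

Lemma del_indep_set0 : set0 \in del_indep.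
Proof. by rewrite inE indep_set0 sub0set. Qed.

Lemma del_indep_subset (X Y : {set T}) :
  X \subset Y -> Y \in del_indep -> X \in del_indep.
Proof.
move=> sXY; rewrite !inE => /andP[iY sY].
by rewrite (indep_subset sXY iY) (subset_trans sXY sY).
Qed.

Lemma del_indep_augment (X Y : {set T}) :
  X \in del_indep -> Y \in del_indep -> #|X| < #|Y| ->
  exists2 y, y \in Y :\: X & y |: X \in del_indep.
Proof.
rewrite !inE => /andP[iX sX] /andP[iY sY] ltXY.
have [y yYX iyX] := indep_augment iX iY ltXY; exists y => //.
rewrite inE iyX subUset sX sub1set andbT.
by apply: (subsetP sY); case/setDP: yYX.
Qed.

Definition deletion : matroid T :=
  Matroid del_indep_ground del_indep_set0 del_indep_subset del_indep_augment.

End Deletion.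

(* X = {x_k : k in K} with the x_k distinct and x_k in A_k.  The choice
   function x lives on the subtype K so that K = set0 is allowed even when T
   is empty. *)
Definition partial_transversal (T J : finType) (A : J -> {set T})
    (X : {set T}) : Prop :=
  exists (K : {set J}) (x : {k : J | k \in K} -> T),
    [/\ injective x,
        forall k, x k \in A (val k)
      & X = [set x k | k : {k : J | k \in K}]].

(* M = M[A]; the indexed family A plays the role of a multiset of subsets. *)
Definition presentation (T J : finType) (M : matroid T) (A : J -> {set T})
    : Prop :=
  (forall j, A j \subset ground M) /\
  (forall X : {set T}, X \in indep M <-> partial_transversal A X).

(* The empty permutation of the empty set counts as cyclic, so that the
   deletion of the only element of a matroid is covered. *)
Definition cyclic_perm_on (T : finType) (E : {set T}) (sigma : {perm T})
    : Prop :=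
  perm_on E sigma /\ {in E &, forall x y, y \in porbit sigma x}.

(* {f, sigma f, ..., l} with l = sigma^n f. *)
Definition sigma_interval (T : finType) (E : {set T}) (sigma : {perm T})
    (I : {set T}) : Prop :=
  exists (f : T) (n : nat),
    [/\ f \in E, n < #|E| & I = [set y in traject sigma f n.+1]].

(* In terms of indices, so an antichain has no repeated member. *)
Definition antichain (T J : finType) (A : J -> {set T}) : Prop :=
  forall i j : J, i != j -> ~~ (A i \subset A j).

Definition multi_path_matroid (T : finType) (M : matroid T) : Prop :=
  exists (sigma : {perm T}) (J : finType) (A : J -> {set T}),
    [/\ cyclic_perm_on (ground M) sigma,
        forall j, sigma_interval (ground M) sigma (A j),
        antichain A
      & presentation M A].

(* Main.v *)
Require Import Defs.
From mathcomp Require Import all_boot all_fingroup.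

Set Implicit Arguments.
Unset Strict Implicit.
Unset Printing Implicit Defensive.

(** Deleting [x] from every interval of an antichain presentation of [M], and
    bypassing [x] in the cyclic permutation, gives a presentation of [M \ x] by
    intervals, some of which may be empty or contain others.  If [A_i] is
    contained in [A_j] and [e] is in [A_i], replacing [A_j] by [A_j - e] does
    not change the matroid: when [e] is matched to [j], exchange the roles of
    [i] and [j].  To keep intervals, [e] has to be an end of [A_j], so one
    maintains the invariant that whenever [A_i] is contained in [A_j], it
    contains an end of [A_j].  The invariant holds initially because such an
    inclusion can only arise from [x] being in the original [A_i] but not in
    [A_j], so that a neighbour of [x] in [A_i] is an end of [A_j]; it survives
    trimming if [A_j] is always chosen of maximal size.  When no inclusion
    between nonempty members is left, the nonempty members form an antichain. *)

(** * Matchings of elements to indices *)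

Section Matchings.

Variables (T J : finType).
Implicit Types (s : J -> seq T) (X : {set T}).

(** Directed from elements to indices, so that exchanging two indices is composition with a
    transposition; [option] gives a value outside [X] even when [J] is empty. *)
Definition matchable s X : Prop :=
  exists2 g : T -> option J, {in X &, injective g}
  & forall y, y \in X -> exists2 j, g y = Some j & y \in s j.

Lemma partial_transversalP (A : J -> {set T}) s X :
  (forall j, A j =i s j) -> partial_transversal A X <-> matchable s X.
Proof.
move=> As; split=> [[K [c [c_inj cA ->]]]|[g g_inj gs]].
  pose g y := omap val [pick k | c k == y].
  have gE k : g (c k) = Some (val k).
    rewrite /g; case: pickP => [k' /eqP/c_inj-> //|/(_ k)].
    by rewrite eqxx.
  exists g => [_ _ /imsetP[k _ ->] /imsetP[l _ ->]|_ /imsetP[k _ ->]].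
    by rewrite !gE => -[/val_inj->].
  by exists (val k); rewrite ?gE -?As.
(* [c] chooses a preimage under [g] of each index used on [X]: it is injective because [g] is a
   function, and reaches all of [X] because [g] is injective there. *)
pose K := [set j | [exists y in X, g y == Some j]].
have ex_c (k : {k : J | k \in K}) :
    exists y, (y \in X) && (g y == Some (val k)).
  by case: k => k /=; rewrite inE => /existsP.
pose c k := xchoose (ex_c k).
have cP k : c k \in X /\ g (c k) = Some (val k).
  by have /andP[? /eqP] := xchooseP (ex_c k).
exists K, c; split.
- move=> k l ekl; apply: val_inj; apply: Some_inj.
  by rewrite -(cP k).2 -(cP l).2 ekl.
- move=> k; have [ckX gck] := cP k; rewrite As.
  by have [j] := gs _ ckX; rewrite gck => -[<-].
- apply/setP=> y; apply/idP/imsetP=> [yX|[k _ ->]]; last by case: (cP k).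
  have [j gy _] := gs y yX.
  have jK : j \in K by rewrite inE; apply/existsP; exists y; rewrite yX gy /=.
  exists (exist _ j jK) => //; have [cX gc] := cP (exist _ j jK).
  by apply: g_inj => //; rewrite gy gc.
Qed.

Definition update s j t := fun k => if k == j then t else s k.

Lemma matchable_update s i j t e X :
    i != j -> {subset s i <= s j} -> e \in s i ->
    t =i [predD1 s j & e] ->
  matchable (update s j t) X <-> matchable s X.
Proof.
move=> neq_ij sij ei tE; split=> [[g g_inj gs]|[g g_inj gs]].
  exists g => // y /gs[k gy]; rewrite /update; case: eqP => [kj|_ ys].
    by rewrite tE => /andP[_ yj]; exists j; rewrite // gy kj.
  by exists k.
have [/andP[eX /eqP ge]|not_ge] := boolP ((e \in X) && (g e == Some j)).
  (* After the swap [e] is matched to [i]. An element previously matched to [i] goes to [j]; it lies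
     in [s j] by inclusion and differs from [e], which was matched to [j]. *)
  exists (fun y => omap (tperm i j) (g y)) => [y z yX zX eyz|y yX].
    by apply: g_inj => //; apply: inj_omap eyz; apply: perm_inj.
  have [k gy yk] := gs y yX; exists (tperm i j k); rewrite ?gy // /update.
  case: tpermP => [ki|kj|/eqP ki /eqP kj].
  - rewrite eqxx tE !inE sij -?ki // andbT; apply: contra_neq neq_ij => ye.
    by apply: Some_inj; rewrite -ki -gy -ge ye.
  - rewrite (negPf neq_ij); suff -> : y = e by [].
    by apply: g_inj => //; rewrite gy ge kj.
  - by rewrite (negPf kj).
exists g => // y yX; have [k gy yk] := gs y yX; exists k => //.
rewrite /update; case: eqP => // kj; rewrite tE !inE -kj yk andbT.
by apply: contra not_ge => /eqP <-; rewrite yX gy kj eqxx.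
Qed.

Lemma matchable_sub s X :
  matchable s X <->
  exists2 g : T -> option {j | s j != [::]}, {in X &, injective g}
  & forall y, y \in X -> exists2 j, g y = Some j & y \in s (val j).
Proof.
split=> [[g g_inj gs]|[g g_inj gs]].
  exists (fun y => obind insub (g y)) => [y z yX zX|y yX].
    have [j gy yj] := gs y yX; have [k gz zk] := gs z zX.
    have nj : s j != [::] by case: (s j) yj.
    have nk : s k != [::] by case: (s k) zk.
    rewrite gy gz /= !(insubT (fun j => s j != [::])) => -[jk].
    by apply: g_inj; rewrite // gy gz jk.
  have [j gy yj] := gs y yX.
  have nj : s j != [::] by case: (s j) yj.
  exists (Sub j nj); rewrite // gy /=.
  exact: (insubT (fun j => s j != [::])).
exists (fun y => omap val (g y)) => [y z yX zX eyz|y yX].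
  by apply: g_inj => //; apply: inj_omap eyz; apply: val_inj.
by have [j gy yj] := gs y yX; exists (val j); rewrite ?gy.
Qed.

Lemma matchable_filter s x X :
  matchable (fun j => [seq y <- s j | y != x]) X <->
  matchable s X /\ x \notin X.
Proof.
split=> [[g g_inj gs]|[[g g_inj gs] xX]].
  split; last first.
    by apply/negP=> /gs[j _]; rewrite mem_filter eqxx.
  exists g => // y /gs[j gy]; rewrite mem_filter => /andP[_ ?].
  by exists j.
exists g => // y yX; have [j gy yj] := gs y yX; exists j => //.
by rewrite mem_filter yj andbT; apply: contraNneq xX => <-.
Qed.

End Matchings.

(** * Arcs of a permutation and their ends *)

Section Arcs.

Variables (T : finType) (sigma : {perm T}).
Implicit Types (s t : seq T).

(** A list rather than a set, because the ends of an arc filling a whole cycle cannot be read off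
    its set of elements. The empty arc is allowed. *)
Definition arc s := sorted (frel sigma) s && uniq s.

Definition ends s := if s is a :: t then [:: a; last a t] else [::].

Lemma ends_rcons s b : ends (rcons s b) = [:: head b s; b].
Proof. by case: s => //= a s; rewrite last_rcons. Qed.

(** Every element but the last is followed by its image, so [y] must be last. *)
Lemma sorted_last_exit s y : sorted (frel sigma) s ->
  y \in s -> sigma y \notin s -> y \in ends s.
Proof.
move=> ss /path.splitPr ps; case: ps ss => p1 p2.
case: p2 => [|b p2]; first by rewrite cats1 ends_rcons !inE eqxx orbT.
rewrite -[p1 ++ _]cat_rcons; case: p1 => [|a p1] /=.
  by case/andP=> /eqP<- _; rewrite !inE eqxx orbT.
rewrite cat_path last_rcons /= => /and3P[_ /eqP<- _].
by rewrite !(inE, mem_cat) eqxx !orbT.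
Qed.

(** By injectivity of [sigma], every element but the first is preceded by its preimage, so [sigma y]
    must be first. *)
Lemma sorted_head_entry s y : sorted (frel sigma) s ->
  sigma y \in s -> y \notin s -> sigma y \in ends s.
Proof.
move=> ss /path.splitPr ps; case: ps ss => p1 p2.
case: p1 / lastP => [|p1 a]; first by rewrite /= !inE eqxx.
rewrite cat_rcons; case: p1 => [|b p1] /=.
  by case/andP=> /eqP/perm_inj-> _; rewrite inE eqxx.
rewrite cat_path /= => /and4P[_ _ /eqP/perm_inj-> _].
by rewrite !(inE, mem_cat) eqxx !orbT.
Qed.

(** Some element other than [x] survives, so [x] has a successor or a predecessor in the list. *)
Lemma arc_neighbour s x : arc s -> x \in s ->
    [seq y <- s | y != x] != [::] ->
  (sigma x != x) && (sigma x \in s) \/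
  exists y, [/\ sigma y = x, y != x & y \in s].
Proof.
move=> /andP[ss us] /path.splitPr ps; case: ps ss us => p1 [|b p2].
  case: p1 / lastP => [|p1 a]; first by rewrite /= eqxx.
  rewrite cat_rcons => ss us _; right; exists a.
  have -> : a != x.
    by move: us; rewrite cat_uniq /= inE => /and3P[_ _ /andP[]].
  split=> //; last by rewrite mem_cat inE eqxx orbT.
  case: p1 ss {us} => [|c p1] /=; first by case/andP=> /eqP.
  by rewrite cat_path /= => /and4P[_ _ /eqP].
rewrite cat_uniq => ss /and3P[_ _ /= /andP[xbp _]] _; left.
have -> : sigma x = b.
  case: p1 ss => [|a p1] /=; first by case/andP=> /eqP.
  by rewrite cat_path /= => /and4P[_ _ /eqP].
move: xbp; rewrite inE => /norP[xb _].
by rewrite eq_sym xb !(mem_cat, inE) eqxx !orbT.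
Qed.

Lemma arc_behead a s : arc (a :: s) -> arc s.
Proof. by rewrite /arc /= => /andP[/path_sorted-> /andP[]]. Qed.

Lemma arc_belast a s : arc (rcons s a) -> arc s.
Proof.
rewrite /arc rcons_uniq => /andP[ss /andP[_ ->]]; rewrite andbT.
by case: s ss => //= b s; rewrite rcons_path => /andP[].
Qed.

Lemma arc_traject s a : arc (a :: s) -> a :: s = traject sigma a (size s).+1.
Proof. by rewrite /arc /= => /andP[/fpathE-> _]; rewrite size_traject. Qed.

Lemma arc_trim s e : arc s -> e \in ends s ->
  exists t, [/\ arc t, t =i [predD1 s & e],
    {in ends s, forall z, z != e -> z \in ends t}
  & forall v, sorted (frel sigma) v -> e \notin v -> t != [::] ->
      {subset t <= v} -> has (mem t) (ends v)].
Proof.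
move=> ars; have us : uniq s by case/andP: ars.
case: s / lastP ars us => [|s b ars us]; first by [].
rewrite ends_rcons !inE => /orP[]/eqP->; last first.
  have bs : b \notin s by move: us; rewrite rcons_uniq => /andP[].
  exists s; split=> [|z|z|v sv bv].
  - exact: arc_belast ars.
  - by rewrite !inE mem_rcons inE; case: eqP => // ->; rewrite (negPf bs).
  - by case: s {ars us bs} => [|a s]; rewrite !inE => /orP[]/eqP->;
      rewrite /= ?inE ?eqxx.
  (* [v] contains the new last element [a] but not its image [b], so [v] stops at [a]. *)
  case: s / lastP ars {us bs} => // s a ars _ av.
  have ab : sigma a = b.
    case/andP: ars => + _; case: s {av} => [|c s] /=; first by case/andP=> /eqP.
    by rewrite !rcons_path last_rcons => /andP[_ /eqP].
  have aa : a \in rcons s a by rewrite mem_rcons inE eqxx.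
  by apply/hasP; exists a => //; apply: sorted_last_exit (av _ aa) _; rewrite ?ab.
case: s ars us => [|a s] ars us.
  exists [::]; split=> // z; first by rewrite !inE andNb.
  by rewrite !inE orbb => /eqP->; rewrite eqxx.
exists (rcons s b); split=> [|z|z|v sv av _ bv] /=.
- exact: arc_behead ars.
- by case/andP: us => + _; rewrite !inE; case: eqP => // -> /negPf->.
- by rewrite ends_rcons !inE => /orP[]/eqP->; rewrite ?eqxx ?orbT.
(* [v] contains the new head [sigma a] but not [a], so [v] starts at [sigma a]. *)
have sa : sigma a \in rcons s b.
  case/andP: ars => + _; case: s {us av bv} => [|c s] /= /andP[/eqP-> _].
    by rewrite inE.
  by rewrite inE eqxx.
by apply/hasP; exists (sigma a) => //; apply: sorted_head_entry (bv _ sa) _.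
Qed.

End Arcs.

(** * Trimming until no inclusion remains *)

Section Trimming.

Variables (T J : finType) (sigma : {perm T}).
Implicit Types (s : J -> seq T).

Definition ends_met s := forall i j, i != j -> s i != [::] ->
  {subset s i <= s j} -> has (mem (s i)) (ends (s j)).

Definition incl s (p : J * J) :=
  [&& p.1 != p.2, s p.1 != [::] & all (mem (s p.2)) (s p.1)].

(* [t] is [s j] without its end [e]; the last hypothesis says that a member
   containing [t] but not [e] has the neighbour of [e] as an end. *)
Lemma ends_met_update s j t e :
    (forall k, uniq (s k)) -> ends_met s ->
    (forall k, k != j -> {subset s j <= s k} -> size (s k) <= size (s j)) ->
    t =i [predD1 s j & e] -> uniq t -> e \in s j ->
    {in ends (s j), forall z, z != e -> z \in ends t} ->
    (forall k, e \notin s k -> t != [::] -> {subset t <= s k} ->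
       has (mem t) (ends (s k))) ->
  ends_met (update s j t).
Proof.
move=> us ms max_j tE ut ej endsP nbr k l neq_kl; rewrite /update.
have [kj|neq_kj] := eqVneq k j; have [lj|neq_lj] := eqVneq l j.
- by rewrite kj lj eqxx in neq_kl.
(* The trimmed member lies in [s l]. If [e] is in [s l], maximality forces [s l] to have the same
   elements as [s j]; having at least two, it has distinct ends, and one that is not [e] lies in
   [t]. *)
- move=> t0 tl; have [el|] := boolP (e \in s l); last by move/nbr; apply.
  have jl : {subset s j <= s l}.
    by move=> z zj; have [->//|ze] := eqVneq z e; apply: tl; rewrite tE !inE ze.
  have [szE memE] := uniq_min_size (us j) jl (max_j _ neq_lj jl).
  have sz_t : size (s j) = (size t).+1.
    have eqm : e :: t =i s j.
      by move=> z; rewrite inE tE !inE; case: eqP => // ->.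
    have ue : uniq (e :: t) by rewrite /= tE !inE eqxx.
    by rewrite -(perm_size (uniq_perm ue (us j) eqm)).
  have := us l; case: (s l) szE memE => [|a [|b r]] szE memE.
  - by rewrite sz_t in szE.
  - by case: (t) t0 sz_t szE => // c t' _ -> [].
  move=> /= /andP[abr _]; have [ae|ae] := eqVneq a e.
    have lr : last b r \in b :: r by rewrite mem_last.
    rewrite ae in abr *; rewrite (_ : last b r \in t) ?orbT //.
    rewrite tE !inE memE inE lr orbT andbT.
    by apply: contraNneq abr => <-.
  by rewrite tE !inE ae memE inE eqxx.
(* The end of [s j] met by [s k] is not [e], since [s k] lies in [t]; hence it is still an end of
   [t]. *)
- move=> k0 kt; have kj : {subset s k <= s j}.
    by move=> z /kt; rewrite tE => /andP[].
  have /hasP[z zj zk] := ms k j neq_kj k0 kj.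
  apply/hasP; exists z => //; apply: endsP => //.
  by have := kt _ zk; rewrite tE => /andP[].
- exact: ms.
Qed.

Lemma trim_to_antichain s (E : {set T}) :
    (forall j, arc sigma (s j)) -> (forall j, {subset s j <= E}) ->
    ends_met s ->
  exists s', [/\ forall j, arc sigma (s' j), forall j, {subset s' j <= E},
    forall p, ~~ incl s' p &
    forall X, matchable s' X <-> matchable s X].
Proof.
(* Induction on the total length, which each trimming lowers. *)
have [m] := ubnP (\sum_j size (s j)); elim: m s => // m IHm s lt_sm arcs sE ms.
have [/existsP[p0 inc0]|no_incl] := boolP [exists p, incl s p]; last first.
  by exists s; split=> // p; apply: contra no_incl => ?; apply/existsP; exists p.
have us k : uniq (s k) by case/andP: (arcs k).
case: (arg_maxnP (fun p : J * J => size (s p.2)) inc0) => -[i j].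
case/and3P=> /= neq_ij i0 /allP ij max_ij.
have j0 : s j != [::].
  by case: (s i) i0 ij => // a r _ /(_ a); rewrite inE eqxx; case: (s j) => // /(_ isT).
(* A member containing [s j] forms an inclusion with it, so the choice of the pair bounds its
   size. *)
have max_j k : k != j -> {subset s j <= s k} -> size (s k) <= size (s j).
  move=> kj jk; apply: (max_ij (j, k)); rewrite /incl /= eq_sym kj j0.
  exact/allP.
have /hasP[e e_end ei] := ms _ _ neq_ij i0 ij.
have ej := ij _ ei; have [t [art tE t_ends nbr]] := arc_trim (arcs j) e_end.
have [_ ut] := andP art.
have lt_sz : size t < size (s j).
  have ue : uniq (e :: t) by rewrite /= tE !inE eqxx.
  apply: (uniq_leq_size ue) => z; rewrite inE tE !inE.
  by case: eqP => [-> //|_].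
case: (IHm (update s j t)).
- rewrite -ltnS (leq_trans _ lt_sm) // ltnS.
  rewrite [X in _ < X](bigD1 j) //= (bigD1 j) //= /update eqxx -addSn.
  by apply: leq_add => //; apply: leq_sum => k /negPf->.
- by move=> k; rewrite /update; case: eqP.
- move=> k z; rewrite /update; case: eqP => _; last exact: sE.
  by rewrite tE => /andP[_]; apply: sE.
- apply: (ends_met_update us ms max_j tE) => // k.
  by apply: nbr; case/andP: (arcs k).
move=> s' [? ? ? eqX]; exists s'; split=> // X.
exact: iff_trans (eqX X) (matchable_update X neq_ij ij ei tE).
Qed.

End Trimming.

(** * Bypassing an element of a cyclic permutation *)

Section Bypass.

Variables (T : finType) (sigma : {perm T}) (x : T).

(** Products act left to right: [x] becomes fixed and its predecessor is sent to [sigma x]. *)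
Definition bypass : {perm T} := (sigma * tperm x (sigma x))%g.

Lemma bypassE y : y != x ->
  bypass y = if sigma y == x then sigma x else sigma y.
Proof.
move=> yx; rewrite permM; case: tpermP => [->|/perm_inj/eqP|/eqP/negPf->] //.
  by rewrite eqxx.
by rewrite (negPf yx).
Qed.

Lemma bypass_fix : bypass x = x.
Proof. by rewrite permM tpermR. Qed.

Lemma filter_traject f n : exists m,
  [seq y <- traject sigma f n | y != x] =
  traject bypass (if f == x then sigma x else f) m.
Proof.
elim: n f => [|n IHn] f; first by exists 0.
have [m eqm] := IHn (sigma f); rewrite /=; case: eqVneq => [fx|fx] /=.
  rewrite eqm fx; have [sx|_] := eqVneq (sigma x) x; last by exists m.
  by exists m; rewrite sx.
by exists m.+1; rewrite eqm /= bypassE.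
Qed.

Lemma cyclic_perm_on_bypass (E : {set T}) :
  x \in E -> cyclic_perm_on E sigma -> cyclic_perm_on (E :\ x) bypass.
Proof.
move=> xE [onE cyc]; split=> [|y z].
  apply/subsetP=> y; rewrite !inE; have [->|yx] := eqVneq y x.
    by rewrite bypass_fix eqxx.
  apply: contraR => yE; rewrite bypassE // (out_perm onE yE).
  by rewrite (negPf yx).
rewrite !inE => /andP[yx yE] /andP[zx zE].
have := cyc _ _ yE zE; rewrite porbit_traject => zy.
(* The whole [sigma]-orbit of [y] without [x] is a segment of the [bypass]-orbit of [y], and it
   contains [z]. *)
have [m] := filter_traject y #|porbit sigma y|.
move/(congr1 (fun r => z \in r)); rewrite mem_filter zx zy (negPf yx).
move/esym/trajectP=> [k _ ->]; apply/porbitP; exists k.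
by rewrite permX.
Qed.

Lemma arc_filter s : arc sigma s -> arc bypass [seq y <- s | y != x].
Proof.
case: s => // a s /[dup] /andP[_ us] /arc_traject eqs.
rewrite /arc filter_uniq // andbT eqs.
have [[|m] ->] := filter_traject a (size s).+1 => //.
exact: fpath_traject.
Qed.

Lemma ends_met_filter (J : finType) (s : J -> seq T) :
    (forall j, arc sigma (s j)) ->
    (forall i j, i != j -> ~ {subset s i <= s j}) ->
  ends_met (fun j => [seq y <- s j | y != x]).
Proof.
move=> arcs anti i j neq_ij i0 ij.
have [xi xj] : x \in s i /\ x \notin s j.
  have /allPn[z zi zj] : ~~ all (mem (s j)) (s i).
    by apply/allP; apply: anti.
  have zx : z = x.
    apply/eqP; apply: contraNT zj => zx.
    by have := ij z; rewrite !mem_filter zx zi => /(_ isT).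
  by rewrite -zx.
have -> : [seq y <- s j | y != x] = s j.
  by apply/all_filterP/allP=> y yj; apply: contraNneq xj => <-.
have sj : sorted (frel sigma) (s j) by case/andP: (arcs j).
have inj y : y != x -> y \in s i -> y \in s j.
  by move=> yx yi; have := ij y; rewrite !mem_filter yx yi => /(_ isT).
(* As [x] is not in [s j], the arc [s j] starts at [sigma x] in the first case and stops at the
   preimage of [x] in the second. *)
have [/andP[sx si]|[y [yx nyx yi]]] := arc_neighbour (arcs i) xi i0.
  apply/hasP; exists (sigma x); last by rewrite /= mem_filter sx.
  by apply: sorted_head_entry => //; apply: inj.
apply/hasP; exists y; last by rewrite /= mem_filter nyx.
by apply: sorted_last_exit sj (inj _ nyx yi) _; rewrite yx.
Qed.

End Bypass.

(** * Intervals as arcs, and closure under deletion *)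

Lemma sigma_interval_arc (T : finType) (E : {set T}) (sigma : {perm T})
    (I : {set T}) : cyclic_perm_on E sigma -> sigma_interval E sigma I ->
  exists s, [/\ arc sigma s, {subset s <= E} & I =i s].
Proof.
move=> [onE cyc] [f [n [fE ltnE ->]]]; exists (traject sigma f n.+1).
have iterE k : iter k sigma f \in E.
  by elim: k => //= k IHk; rewrite (perm_closed _ onE).
split; last by move=> y; rewrite inE.
  rewrite /arc /= fpath_traject.
  (* The orbit of [f] covers [E], so the interval is a prefix of a repetition-free traversal of that
     orbit. *)
  have leEp : n.+1 <= #|porbit sigma f|.
    by apply: leq_trans ltnE (subset_leq_card _); apply/subsetP=> y; apply: cyc.
  have := uniq_traject_porbit sigma f.
  rewrite -(subnKC leEp) -[_ && _]/(uniq (traject sigma f n.+1)).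
  by rewrite trajectD cat_uniq => /andP[].
by move=> _ /trajectP[k _ ->].
Qed.

Lemma arc_sigma_interval (T : finType) (E : {set T}) (sigma : {perm T}) s :
    arc sigma s -> {subset s <= E} -> s != [::] ->
  sigma_interval E sigma [set y in s].
Proof.
case: s => // a s ars sE _; exists a, (size s); split.
- by apply: sE; rewrite inE eqxx.
- have [_ us] := andP ars; rewrite -[_.+1]/(size (a :: s)) -(card_uniqP us).
  by apply: subset_leq_card; apply/subsetP.
- by rewrite -arc_traject.
Qed.

Theorem theorem3p3 (T : finType) (M : matroid T) (x : T)
    (hM : multi_path_matroid M) (hx : x \in ground M) :
  multi_path_matroid (deletion M x).
Proof.
have [sigma [J [A [cyc intA antiA [_ presA]]]]] := hM.
have [s sP] := fin_all_exists (fun j => sigma_interval_arc cyc (intA j)).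
have anti i j : i != j -> ~ {subset s i <= s j}.
  move=> /antiA/subsetP not_ij ij; apply: not_ij => y.
  by have [[_ _ ->] [_ _ ->]] := (sP i, sP j); apply: ij.
have arcs j : arc sigma (s j) by case: (sP j).
case: (@trim_to_antichain _ _ (bypass sigma x)
  (fun j => [seq y <- s j | y != x]) (ground M :\ x)).
- by move=> j; apply: arc_filter.
- move=> j y; rewrite mem_filter !inE => /andP[-> ys].
  by have [_ + _] := sP j; apply.
- exact: ends_met_filter anti.
move=> s' [arcs' s'E no_incl eqX].
exists (bypass sigma x), {j | s' j != [::]}, (fun j => [set y in s' (val j)]).
split.
- exact: cyclic_perm_on_bypass.
- by move=> j; apply: arc_sigma_interval => //; apply: (valP j).
- move=> i j neq_ij; have := no_incl (val i, val j).
  rewrite /incl (valP i) /= (inj_eq val_inj) neq_ij /=.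
  apply: contra => /subsetP ij; apply/allP=> y yi.
  by have := ij y; rewrite !inE; apply.
split=> [j|X]; first by apply/subsetP=> y; rewrite inE => /s'E.
have delP : X \in indep (deletion M x) <-> matchable s X /\ x \notin X.
  have XP : X \in indep M <-> matchable s X.
    apply: iff_trans (presA X) (partial_transversalP _ _) => j.
    by case: (sP j).
  rewrite inE; split=> [/andP[/[dup] iX /XP sX XE]|[/XP iX xX]].
    by split=> //; apply/negP=> /(subsetP XE); rewrite !inE eqxx.
  by rewrite iX subsetD1 (indep_ground iX).
(* In turn: filtering out [x], trimming, dropping empty members, and back to partial
   transversals. *)
apply: iff_trans delP _; apply: iff_trans (iff_sym (matchable_filter _ _ _)) _.
apply: iff_trans (iff_sym (eqX X)) _.
apply: iff_trans (matchable_sub _ _) (iff_sym (partial_transversalP _ _)) => j.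
by move=> y; rewrite inE.
Qed.
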